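(* A modular Lie algebra structure and a unimodular Lie algebra structure $\mathfrak g$ on the same finite-dimensional vector space with $\mathfrak g=[\mathfrak g,\mathfrak g]$ are never compatible. In particular, a semi-simple Lie algebra cannot be the unimodular part of a non-unimodular Lie algebra.
   Context: Lie algebras are finite-dimensional over a field $\mathbf k$ of characteristic zero. Two Lie algebra structures on a vector space $V$ are compatible if the sum of their brackets is a Lie bracket. A Lie algebra is unimodular if $\operatorname{tr}(\operatorname{ad}u)=0$ for all $u$. A modular Lie algebra is one of the form $W_0\oplus W_1$ with $\dim W_1=1$, $0\neq e\in W_1$, and bracket $[u,v]=0$ for $u,v\in W_0$ and $[u,e]=A_0(u)$ for $u\in W_0$, where $A_0:W_0\to W_0$ is linear with $\operatorname{tr}A_0\neq0$. For a non-unimodular Lie algebra $\mathfrak g$ on $V$ with bracket $[\cdot,\cdot]$, let $\theta\in V^*$, $\theta(u)=-\operatorname{tr}(\operatorname{ad}u)$, and let $\nu\in V$ with $\theta(\nu)=1$. Put $[u,v]_{non}=\theta(u)[\nu,v]-\theta(v)[\nu,u]$. This is a modular Lie algebra structure compatible with $\mathfrak g$, and $[\cdot,\cdot]-[\cdot,\cdot]_{non}$ is a unimodular Lie algebra structure compatible with $[\cdot,\cdot]_{non}$; it is called a unimodular part of $\mathfrak g$ (it depends on the choice of $\nu$). *)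

(* Defs.v *)
From mathcomp Require Export all_boot all_order all_algebra.

Set Implicit Arguments.
Unset Strict Implicit.
Unset Printing Implicit Defensive.

Import GRing.Theory.
Local Open Scope ring_scope.

Section LieBrackets.

Variables (k : fieldType) (V : vectType k).
Implicit Types (br : V -> V -> V) (U W I : {vspace V}).

Record is_lie br : Prop := IsLie {
  lie_linear_l : forall v, linear (fun u => br u v);
  lie_linear_r : forall u, linear (br u);
  lie_alternating : forall u, br u u = 0;
  lie_jacobi : forall u v w, br u (br v w) + br v (br w u) + br w (br u v) = 0
}.

Definition compatible br1 br2 : Prop := is_lie (fun u v => br1 u v + br2 u v).

Definition lfun_trace (T : vectType k) (f : 'End(T)) : k :=
  \tr (passmx.mxof (vbasis {:T}) (vbasis {:T}) f).

(* [linfun f] agrees with [f] only for linear [f], so [ad br] is the adjoint map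
   only under [is_lie br]. *)
Definition ad br (u : V) : 'End(V) := linfun (br u).

Definition unimodular br : Prop := forall u, lfun_trace (ad br u) = 0.

(* By bilinearity, brackets of basis elements suffice to span [U, W]
   (compare [prodv]). *)
Definition lie_prod br U W : {vspace V} :=
  <<allpairs br (vbasis U) (vbasis W)>>%VS.

Definition perfect_lie br : Prop := lie_prod br fullv fullv = fullv.

Definition lie_ideal br I : Prop := (lie_prod br fullv I <= I)%VS.

Definition derived_series br I (n : nat) : {vspace V} :=
  iter n (fun U => lie_prod br U U) I.

Definition solvable_lie br I : Prop := exists n, derived_series br I n = 0%VS.

Definition semisimple_lie br : Prop :=
  forall I, lie_ideal br I -> solvable_lie br I -> I = 0%VS.

Definition modular br : Prop :=
  is_lie br /\
  exists (W0 W1 : {vspace V}) (e : V) (A0 : 'End(subvs_of W0)),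
    [/\ (W0 + W1)%VS = fullv /\ directv (W0 + W1),
        [/\ \dim W1 = 1%N, e \in W1 & e != 0],
        lfun_trace A0 != 0,
        forall u v, u \in W0 -> v \in W0 -> br u v = 0 &
        forall u : subvs_of W0, br (vsval u) e = vsval (A0 u)].

Definition theta br (u : V) : k := - lfun_trace (ad br u).

Definition non_part br (nu u v : V) : V :=
  theta br u *: br nu v - theta br v *: br nu u.

Definition unimodular_part br br0 : Prop :=
  exists2 nu : V, theta br nu = 1 &
    forall u v, br0 u v = br u v - non_part br nu u v.

End LieBrackets.

(* Main.v *)
From HB Require Import structures.
Require Import Defs.
From mathcomp Require Import all_boot all_order all_algebra.

Import GRing.Theory.
Local Open Scope ring_scope.

(** The trace of the adjoint map of a Lie bracket kills every bracket, because
[ad [u, v]] is the commutator of [ad u] and [ad v].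

Let [m] be modular, [g] unimodular and perfect, and suppose that [m + g] is a
Lie bracket.  Adjoint maps add up, so unimodularity of [g] says that [m + g]
and [m] have the same trace functional [t u = tr (ad u)].  It kills the
brackets of [m + g] and those of [m], hence those of [g], hence everything
since [g] is perfect.  But [t e = - tr A0] is nonzero, where [e] spans [W1]:
[ad e] is [- A0] on [W0] and zero on [W1] (lemma [modular_trace_ad]).

For the second claim, subtracting from the bracket of [g] its part
[non_part g nu] makes [nu] central: as [theta nu = 1], both brackets
take the value [g nu v] on [nu] and [v].  So [nu] spans a nonzero abelian ideal
of the unimodular part, which is therefore not semisimple. *)

(** * Traces of linear maps *)

Lemma lfun_trace_linear (k : fieldType) (T : vectType k) :
  linear (fun f : 'End(T) => lfun_trace f : k^o).
Proof. by move=> a f g; rewrite /lfun_trace passmx.mxof_linear linearP. Qed.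

Lemma lfun_traceD (k : fieldType) (T : vectType k) (f g : 'End(T)) :
  lfun_trace (f + g) = lfun_trace f + lfun_trace g.
Proof. by have := lfun_trace_linear _ _ 1 f g; rewrite !scale1r. Qed.

Lemma lfun_trace0 (k : fieldType) (T : vectType k) :
  lfun_trace (0 : 'End(T)) = 0.
Proof.
by have := lfun_trace_linear _ T (-1) 0 0; rewrite !scaleN1r !addNr.
Qed.

Lemma lfun_traceN (k : fieldType) (T : vectType k) (f : 'End(T)) :
  lfun_trace (- f) = - lfun_trace f.
Proof.
by apply/eqP; rewrite -addr_eq0 -lfun_traceD addNr lfun_trace0.
Qed.

Lemma lfun_trace_comp (k : fieldType) (T U : vectType k)
    (f : 'Hom(T, U)) (g : 'Hom(U, T)) :
  lfun_trace (g \o f)%VF = lfun_trace (f \o g)%VF.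
Proof.
have bT := vbasisP {:T}; have bU := vbasisP {:U}.
rewrite /lfun_trace (passmx.mxof_comp _ _ bU f g) (passmx.mxof_comp _ _ bT g f).
exact: mxtrace_mulC.
Qed.

(** * Adjoint maps *)

Section Adjoint.

Context {k : fieldType} {V : vectType k} {br : V -> V -> V}.
Hypothesis br_lie : is_lie br.

Lemma lie_antisym u v : br u v = - br v u.
Proof.
have Dl x y z : br (x + y) z = br x z + br y z.
  by have := lie_linear_l br_lie z 1 x y; rewrite !scale1r.
have Dr x y z : br x (y + z) = br x y + br x z.
  by have := lie_linear_r br_lie x 1 y z; rewrite !scale1r.
have := lie_alternating br_lie (u + v).
rewrite Dl !Dr !(lie_alternating br_lie) add0r addr0.
by move/eqP; rewrite addr_eq0 => /eqP.
Qed.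

Lemma lie0l v : br 0 v = 0.
Proof.
by have := lie_linear_l br_lie v (-1) 0 0; rewrite !scaleN1r !addNr.
Qed.

Lemma lie0r u : br u 0 = 0.
Proof. by rewrite lie_antisym lie0l oppr0. Qed.

Lemma lieZr a u v : br u (a *: v) = a *: br u v.
Proof. by have := lie_linear_r br_lie u a v 0; rewrite lie0r !addr0. Qed.

Lemma lieNr u v : br u (- v) = - br u v.
Proof. by rewrite -!scaleN1r lieZr. Qed.

Lemma adE u v : ad br u v = br u v.
Proof.
pose L := GRing.isLinear.Build _ _ _ _ (br u) (lie_linear_r br_lie u).
pose f : {linear V -> V} := HB.pack (br u) L.
by rewrite /ad -[linfun _]/(linfun f) lfunE.
Qed.

Lemma ad_bracket u v :
  ad br (br u v) = (ad br u \o ad br v)%VF - (ad br v \o ad br u)%VF.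
Proof.
apply/lfunP => w; rewrite add_lfunE opp_lfunE !comp_lfunE !adE.
have := lie_jacobi br_lie u v w.
rewrite [br w u]lie_antisym [br w (br u v)]lie_antisym lieNr.
by move/eqP; rewrite subr_eq0 => /eqP.
Qed.

Lemma trace_ad_bracket u v : lfun_trace (ad br (br u v)) = 0.
Proof.
by rewrite ad_bracket lfun_traceD lfun_traceN lfun_trace_comp subrr.
Qed.

Lemma trace_ad_linear : linear (fun u => lfun_trace (ad br u) : k^o).
Proof.
move=> a u v; have ->: ad br (a *: u + v) = a *: ad br u + ad br v.
  apply/lfunP => w; rewrite add_lfunE scale_lfunE !adE.
  exact: lie_linear_l.
exact: lfun_trace_linear.
Qed.

(** It suffices to test a linear form on the brackets of basis vectors, as
these span. *)
Lemma perfect_form_eq0 (t : V -> k^o) :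
  linear t -> perfect_lie br -> (forall u v, t (br u v) = 0) ->
  forall u, t u = 0.
Proof.
move=> t_lin br_perf t_br u.
pose L := GRing.isLinear.Build _ _ _ _ t t_lin.
pose f : {linear V -> k^o} := HB.pack t L.
have tE x : linfun f x = t x by rewrite lfunE.
suff /subvP/(_ u (memvf u)): ({:V} <= lker (linfun f))%VS.
  by rewrite memv_ker tE => /eqP.
rewrite -br_perf; apply/span_subvP => _ /allpairsP[[x y] [_ _ ->]].
by rewrite memv_ker tE t_br.
Qed.

End Adjoint.

(** * Modular Lie algebras *)

(** In block form along [W0 + W1], the map [ad e] is [- A0] on [W0] and zero on
[W1], so it factors as [- (iota \o A0 \o pi)] with [pi] the projection onto
[W0] and [iota] the inclusion.  Since [pi \o iota] is the identity, cyclicity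
of the trace gives the trace without choosing an adapted basis. *)
Lemma modular_trace_ad (k : fieldType) (V : vectType k) (br : V -> V -> V) :
  modular br -> exists e, lfun_trace (ad br e) != 0.
Proof.
case=> br_lie [W0 [W1 [e [A0 [[WV dxW] [dimW1 W1e e_neq0] trA0 _ brA0]]]]].
exists e; have W01 := directv_addP dxW.
pose iota : 'Hom(subvs_of W0, V) := linfun vsval.
pose pi : 'Hom(V, subvs_of W0) := (linfun (vsproj W0) \o daddv_pi W0 W1)%VF.
suff ->: ad br e = - (iota \o (A0 \o pi))%VF.
  rewrite lfun_traceN oppr_eq0 lfun_trace_comp.
  suff ->: ((A0 \o pi) \o iota)%VF = A0 by [].
  apply/lfunP => u; rewrite !comp_lfunE ![linfun _ _]lfunE /=.
  by rewrite daddv_pi_id ?subvsP// vsvalK.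
have W1E : W1 = <[e]>%VS.
  by apply/esym/eqP; rewrite eqEdim -memvE W1e dimW1 dim_vline e_neq0.
apply/lfunP => v; rewrite adE// opp_lfunE !comp_lfunE ![linfun _ _]lfunE /=.
rewrite -brA0 vsprojK ?memv_pi// -lie_antisym//.
rewrite -[in LHS](daddv_pi_add W01 (w := v)) ?WV ?memvf//.
(* The component along [W1] is a multiple of [e], which [ad e] kills. *)
have /vlineP[c ->] : daddv_pi W1 W0 v \in <[e]>%VS by rewrite -W1E memv_pi.
have := lie_linear_r br_lie e c e (daddv_pi W0 W1 v).
by rewrite lie_alternating// scaler0 add0r addrC.
Qed.

Lemma modular_perfect_incompatible (k : fieldType) (V : vectType k)
    (m g : V -> V -> V) :
  modular m -> is_lie g -> unimodular g -> perfect_lie g -> ~ compatible m g.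
Proof.
move=> m_mod g_lie g_unim g_perf mg_lie.
have [m_lie _] := m_mod; have [e /eqP[]] := modular_trace_ad _ _ _ m_mod.
apply: (perfect_form_eq0 _ (trace_ad_linear m_lie) g_perf) => u v.
have := trace_ad_bracket mg_lie u v; set w := m u v + g u v.
have ->: ad (fun u v => m u v + g u v) w = ad m w + ad g w.
  by apply/lfunP => x; rewrite add_lfunE !adE.
rewrite lfun_traceD g_unim addr0.
have := trace_ad_linear m_lie 1 (m u v) (g u v).
by rewrite !scale1r trace_ad_bracket// add0r => ->.
Qed.

(** * Unimodular parts *)

(** A central vector spans an ideal whose first derived term is zero. *)
Lemma central_semisimple_eq0 (k : fieldType) (V : vectType k)
    (s : V -> V -> V) (z : V) :
  is_lie s -> semisimple_lie s -> (forall v, s z v = 0) -> z = 0.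
Proof.
move=> s_lie s_ss z_central.
have prod0 U : lie_prod s U <[z]>%VS = 0%VS.
  apply/eqP; rewrite -subv0; apply/span_subvP => _ /allpairsP[[x y] [_ y_z ->]].
  have /vlineP[c /= ->] := vbasis_mem y_z.
  by rewrite lieZr// lie_antisym// z_central oppr0 scaler0 mem0v.
suff /s_ss z0 : lie_ideal s <[z]>%VS.
  by apply/eqP; rewrite -memv0 -z0 ?memv_line//; exists 1%N; apply: prod0.
by rewrite /lie_ideal prod0 sub0v.
Qed.

(** On [nu], where [theta] is one, [non_part g nu] agrees with [g], so the
difference of the two brackets vanishes there. *)
Lemma unimodular_part_central (k : fieldType) (V : vectType k)
    (g s : V -> V -> V) :
  is_lie g -> unimodular_part g s ->
  exists2 nu, nu != 0 & forall v, s nu v = 0.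
Proof.
move=> g_lie [nu theta_nu sE]; exists nu.
  apply/eqP => nu0; have := theta_nu; rewrite nu0 /theta.
  have ->: ad g 0 = 0 by apply/lfunP => v; rewrite adE// lie0l// lfunE.
  by rewrite lfun_trace0 oppr0 => /esym/eqP; rewrite oner_eq0.
move=> v; rewrite sE /non_part theta_nu scale1r lie_alternating//.
by rewrite scaler0 subr0 subrr.
Qed.

Theorem corollary4p1 (k : fieldType) (k_char0 : [pchar k] =i pred0)
    (V : vectType k) :
  (forall m g : V -> V -> V,
     modular m -> is_lie g -> unimodular g -> perfect_lie g ->
     ~ compatible m g) /\
  (forall g s : V -> V -> V,
     is_lie g -> ~ unimodular g -> is_lie s -> semisimple_lie s ->
     ~ unimodular_part g s).
Proof.
split=> [m g|g s g_lie _ s_lie s_ss gs].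
  exact: modular_perfect_incompatible.
have [nu /eqP nu_neq0 nu_central] := unimodular_part_central _ _ _ _ g_lie gs.
exact: nu_neq0 (central_semisimple_eq0 _ _ _ _ s_lie s_ss nu_central).
Qed.
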